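(* Let $m,n$ be positive integers and $\xi$ a transcendental real number. Assume that either $m\ge n$, or \[ w_{m}(\xi)>\min\{n+m-1,\,w_{n}^{\ast}(\xi)\}. \] Then \[ \widehat{w}_{n}^{\ast}(\xi)\leq \min\left\{ m+(n-1)\frac{\widehat{w}_{n}^{\ast}(\xi)}{w_{m}(\xi)},\; w_{m}(\xi)\right\}. \] In particular, for every integer $n\ge1$ and every transcendental real $\xi$, \[ \widehat{w}_{n}^{\ast}(\xi)\leq n+(n-1)\frac{\widehat{w}_{n}^{\ast}(\xi)}{w_{n}(\xi)}. \]
   Context: The height $H(P)$ of an integer polynomial $P$ is the maximum of the absolute values of its coefficients; the height $H(\alpha)$ of an algebraic number $\alpha$ is the height of its minimal polynomial over $\mathbb{Z}$. For a real number $\xi$ and integer $k\ge1$: $w_{k}(\xi)\in[0,+\infty]$ is the supremum of the real $w$ such that $0<|P(\xi)|\le H(P)^{-w}$ has infinitely many solutions $P\in\mathbb{Z}[X]$ of degree at most $k$; $w_{k}^{\ast}(\xi)$ is the supremum of the real $w$ such that $0<|\xi-\alpha|\le H(\alpha)^{-w-1}$ has infinitely many solutions in algebraic numbers $\alpha$ of degree at most $k$; $\widehat{w}_{k}^{\ast}(\xi)$ is the supremum of the real $w$ such that for all sufficiently large $H$ there is an algebraic number $\alpha$ of degree at most $k$ with $0<|\xi-\alpha|\le H(\alpha)^{-1}H^{-w}$ and $H(\alpha)\le H$. The value $w_m(\xi)$ may be $+\infty$, in which case $\widehat{w}_n^{\ast}(\xi)/w_m(\xi)$ is interpreted as $0$.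 *)

(* Defs.v *)
From HB Require Import structures.
From mathcomp Require Export all_boot all_order all_algebra.
From mathcomp Require Export all_classical all_reals all_analysis.
From mathcomp Require Export complex.

Set Implicit Arguments.
Unset Strict Implicit.
Unset Printing Implicit Defensive.

Import Order.TTheory GRing.Theory Num.Theory.
Import numFieldNormedType.Exports.

Local Open Scope classical_set_scope.
Local Open Scope ring_scope.
Local Open Scope complex_scope.

Definition pheight (P : {poly int}) : nat :=
  \max_(i < size P) absz (P`_i)%R.

Definition transcendental (R : realType) (xi : R) : Prop :=
  ~ algebraicOver (ratr : rat -> R) xi.

(* [zcontents P] carries the sign of the leading coefficient, so
   [zcontents P = 1] says that P is nonzero, has coprime coefficients and a
   positive leading coefficient. *)
Definition is_minpolyZ (R : realType) (alpha : R[i]) (P : {poly int}) : Prop :=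
  [/\ zcontents P = 1,
      root (map_poly intr P) alpha &
      forall Q : {poly int},
        Q != 0 -> root (map_poly intr Q) alpha -> (size P <= size Q)%N].

(* The value is 0 when alpha is not algebraic. *)
Definition minpolyZ (R : realType) (alpha : R[i]) : {poly int} :=
  xget 0 (is_minpolyZ alpha).

Definition aheight (R : realType) (alpha : R[i]) : nat :=
  pheight (minpolyZ alpha).

Definition algebraic_deg_le (R : realType) (k : nat) (alpha : R[i]) : Prop :=
  algebraicOver (ratr : rat -> R[i]) alpha /\
  ((size (minpolyZ alpha)).-1 <= k)%N.

Definition adist (R : realType) (xi : R) (alpha : R[i]) : R :=
  Normc.normc (xi%:C - alpha).

Definition w_exp (R : realType) (k : nat) (xi : R) : \bar R :=
  ereal_sup [set w%:E | w in [set w : R |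
    infinite_set [set P : {poly int} |
      ((size P).-1 <= k)%N /\
      0 < `|(map_poly intr P).[xi]| <= (pheight P)%:R `^ (- w)]]].

Definition wstar_exp (R : realType) (k : nat) (xi : R) : \bar R :=
  ereal_sup [set w%:E | w in [set w : R |
    infinite_set [set alpha : R[i] |
      algebraic_deg_le k alpha /\
      0 < adist xi alpha <= (aheight alpha)%:R `^ (- w - 1)]]].

Definition what_star_exp (R : realType) (k : nat) (xi : R) : \bar R :=
  ereal_sup [set w%:E | w in [set w : R |
    \forall H \near +oo, exists alpha : R[i],
      [/\ algebraic_deg_le k alpha,
          0 < adist xi alpha <= (aheight alpha)%:R^-1 * H `^ (- w) &
          (aheight alpha)%:R <= H]]].

(* Main.v *)
Require Import Defs.
From mathcomp Require Import perm zify ring lra.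
Set Implicit Arguments.
Unset Strict Implicit.
Unset Printing Implicit Defensive.
Import Order.TTheory GRing.Theory Num.Theory.
Import numFieldNormedType.Exports.
Local Open Scope classical_set_scope.
Local Open Scope ring_scope.

(* Write V for the uniform exponent (degree n) and W for w_m(xi).

   If W > m + n - 1, Gelfond's inequality provides irreducible P of degree at
   most m and large height h with x := |P(xi)| <= h^-w, for any w < W.  Put
   H^m := c / (x h^(n-1)), so that H >= h, and let Q be the minimal polynomial
   of an algebraic number realising the exponent v < V at level H, so that
   |Q(xi)| << H^-v.  Either Q = P, or the resultant gives
     1 << x h^(n-1) H(Q)^m + |Q(xi)| h^n H(Q)^(m-1),
   whose first term is negligible by the choice of H.  Both cases lead to
   x << H^-v, that is V (w - n + 1) <= m w; let w tend to W.

   If W <= m + n - 1, then V <= W: for n <= m because V <= w_n <= w_m, and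
   otherwise because V <= w_n^* < W.  The first bound follows from V <= W. *)

(** * Heights and Gelfond's inequality *)

Lemma coef_le_pheight (P : {poly int}) i : (absz (P`_i)%R <= pheight P)%N.
Proof.
have [lti|gei] := ltnP i (size P); last by rewrite nth_default.
exact: (leq_bigmax (Ordinal lti)).
Qed.

Lemma pheight_leP (P : {poly int}) b :
  reflect (forall i, (absz (P`_i)%R <= b)%N) (pheight P <= b)%N.
Proof.
apply: (iffP idP) => [Pb i|Pb]; first exact: leq_trans (coef_le_pheight P i) Pb.
exact/bigmax_leqP.
Qed.

Lemma pheight_gt0 (P : {poly int}) : P != 0 -> (0 < pheight P)%N.
Proof.
move=> P0; apply: leq_trans (coef_le_pheight P (size P).-1).
by rewrite absz_gt0 -lead_coefE lead_coef_eq0.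
Qed.

Lemma pheightZ_ge (a : int) (P : {poly int}) :
  a != 0 -> (pheight P <= pheight (a *: P))%N.
Proof.
move=> a0; apply/pheight_leP => i.
apply: leq_trans (coef_le_pheight _ i).
by rewrite coefZ abszM leq_pmull// absz_gt0.
Qed.

Lemma horner_norm_le (K : numDomainType) (p : {poly K}) (k : nat) (h X x : K) :
  (size p <= k)%N -> (forall i, `|p`_i| <= h) -> 1 <= X -> `|x| <= X ->
  `|p.[x]| <= k%:R * h * X ^+ k.
Proof.
move=> pk ph X1 xX.
rewrite (horner_coef_wide _ pk) (le_trans (ler_norm_sum _ _ _))//.
rewrite -mulrA mulr_natl -[X in _ *+ X](card_ord k) -sumr_const.
apply: ler_sum => i _.
rewrite normrM normrX ler_pM ?exprn_ge0//.
apply: (@le_trans _ _ (X ^+ i)); last by rewrite ler_weXn2l// ltnW.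
by rewrite lerXn2r ?nnegrE// (le_trans _ xX).
Qed.

(** The recursion mirrors one Newton interpolation step with nodes in [0, N]: passing to the
    quotient doubles the bound on values, multiplying back by X - x costs a factor N + 1, and the
    constant term adds 1. *)
Fixpoint interp_const (N d : nat) : nat :=
  if d is d'.+1 then (1 + 2 * N.+1 * interp_const N d')%N else 1%N.

Lemma interp_const_gt0 N d : (0 < interp_const N d)%N.
Proof. by case: d. Qed.

(** Newton interpolation: write p = p(x) + q (X - x) at one node x and induct on q. At another node
    y, |y - x| >= 1 because the nodes are distinct integers, so |q(y)| <= |p(y) - p(x)| <= 2 e. *)
Lemma interp_coef_le (N d : nat) (p : {poly int}) (s : seq nat) (e : int) :
  (size p <= d)%N -> uniq s -> size s = d -> all (fun x => (x <= N)%N) s ->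
  0 <= e -> (forall x, x \in s -> `|p.[x%:Z]| <= e) ->
  forall i, `|p`_i| <= (interp_const N d)%:Z * e.
Proof.
elim: d p s e => [|d IHd] p s e.
  rewrite leqn0 size_poly_eq0 => /eqP-> _ _ _ e0 _ i.
  by rewrite coef0 normr0 mulr_ge0.
case: s => [//|x s] sp /= /andP[xs us] [ss] /andP[xN sN] e0 ps.
have /factor_theorem[q pE] : root (p - p.[x%:Z]%:P) x%:Z.
  by rewrite rootE !hornerE subrr.
have {}pE : p = p.[x%:Z]%:P + q * ('X - x%:Z%:P) by rewrite -pE addrC subrK.
have sq : (size q <= d)%N.
  have [->|q0] := eqVneq q 0; first by rewrite size_poly0.
  have : (size (q * ('X - x%:Z%:P))%R <= d.+1)%N.
    have -> : q * ('X - x%:Z%:P) = p - p.[x%:Z]%:P.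
      by apply/eqP; rewrite eq_sym subr_eq [_ + _%:P]addrC -pE.
    by rewrite (leq_trans (size_polyD _ _))// geq_max sp size_polyN
      (leq_trans (size_polyC_leq1 _)).
  by rewrite size_Mmonic ?monicXsubC// size_XsubC addn2.
have qs y : y \in s -> `|q.[y%:Z]| <= 2 * e.
  move=> ys.
  have := ps y; rewrite inE ys orbT => /(_ isT) py.
  have px := ps x (mem_head _ _).
  have yx : y != x by apply: contraNneq xs => <-.
  have : `|q.[y%:Z] * (y%:Z - x%:Z)| <= 2 * e.
    rewrite {1}pE !hornerE/= in py.
    move: py px; set A := p.[_]; set B := q.[_] * _.
    lia.
  apply: le_trans; rewrite normrM ler_peMr//; lia.
have {}IHd := IHd q s (2 * e) sq us ss sN (mulr_ge0 (ler0n _ 2) e0) qs.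
move=> i; rewrite pE mulrBr coefD coefB coefC coefMX coefMC /=.
have px := ps x (mem_head _ _).
have q1 := IHd i.-1; have q2 := IHd i.
set K := interp_const N d in q1 q2 *.
have ax : `|if i == 0%N then p.[x%:Z] else 0| <= e by case: ifP.
have bx : `|if i == 0%N then 0 else q`_i.-1| <= K%:Z * (2 * e).
  by case: ifP => // _; rewrite normr0 !mulr_ge0.
have cx : `|q`_i * x%:Z| <= K%:Z * (2 * e) * N%:Z.
  by rewrite normrM ler_pM// normr_nat lez_nat.
have -> : (1 + 2 * N.+1 * K)%N%:Z * e = e + K%:Z * (2 * e) + K%:Z * (2 * e) * N%:Z.
  by rewrite PoszD !PoszM -addn1 PoszD; ring.
apply: le_trans (ler_normD _ _) _; rewrite -addrA lerD//.
by apply: le_trans (ler_normB _ _) _; rewrite lerD.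
Qed.

(** With k such points, interpolation would bound every coefficient of A by its height minus one. *)
Lemma count_small_values (N k : nat) (A : {poly int}) (s : seq nat) :
  A != 0 -> (size A <= k)%N -> uniq s -> all (fun x => (x <= N)%N) s ->
  (count (fun x => interp_const N k * absz A.[x%:Z]%R < pheight A)%N s < k)%N.
Proof.
move=> A0 sA us sN; rewrite ltnNge; apply/negP => kc.
set bad := (fun x => _) in kc.
pose t := take k [seq x <- s | bad x].
have st : size t = k by rewrite size_takel// size_filter.
have ut : uniq t by rewrite take_uniq// filter_uniq.
have tbad x : x \in t -> bad x /\ x \in s.
  by move=> /mem_take; rewrite mem_filter => /andP[].
have tN : all (fun x => (x <= N)%N) t.
  by apply/allP => x /tbad[_ /(allP sN)].
have hA := pheight_gt0 A0.
set K := interp_const N k in bad kc t st ut tbad tN *.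
have K0 : (0 < K)%N by exact: interp_const_gt0.
(* Scaling by K avoids a division: on [t] the values of K A are at most the height of A minus one,
   and K cancels afterwards. *)
have KA0 i : `|(K%:Z *: A)`_i| <= K%:Z * (pheight A).-1%:Z.
  apply: (@interp_coef_le N k _ t) => //.
    by rewrite (leq_trans (size_scale_leq _ _)).
  move=> x /tbad[+ _]; rewrite /bad hornerZ normrM => h.
  rewrite -!abszE -PoszM lez_nat /=; by rewrite -ltnS prednK.
have : (pheight A <= (pheight A).-1)%N.
  apply/pheight_leP => i; have := KA0 i.
  by rewrite coefZ normrM ger0_norm// ler_pM2l ?ltz_nat// -abszE lez_nat.
lia.
Qed.

(* Gelfond's inequality.  Among 2k integer points, fewer than k can make A
   small compared to its height, and likewise for B: some point makes both
   large, hence AB large. *)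
Lemma pheightM_ge (k : nat) : exists2 C : nat, (0 < C)%N &
  forall A B : {poly int}, (size A <= k)%N -> (size B <= k)%N ->
  (pheight A * pheight B <= C * pheight (A * B)%R)%N.
Proof.
pose N := (2 * k)%N; pose K := interp_const N k.
exists (K * K * (N.+1 * N.+1 ^ N.+1))%N.
  by rewrite !muln_gt0 !interp_const_gt0 expn_gt0.
move=> A B sA sB.
have [->|A0] := eqVneq A 0; first by rewrite /pheight size_poly0 big_ord0.
have [->|B0] := eqVneq B 0.
  by rewrite [pheight 0]/pheight size_poly0 big_ord0 muln0.
have sN : all (fun x => (x <= N)%N) (iota 0 N).
  by apply/allP => x; rewrite mem_iota => /andP[_ /ltnW].
have cA := count_small_values A0 sA (iota_uniq 0 N) sN.
have cB := count_small_values B0 sB (iota_uniq 0 N) sN.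
set a := (fun x => _) in cA; set b := (fun x => _) in cB.
have : (count (predU a b) (iota 0 N) < size (iota 0 N))%N.
  rewrite size_iota.
  apply: leq_ltn_trans (leq_addr (count (predI a b) (iota 0 N)) _) _.
  rewrite count_predUI; move: cA cB; set u := count _ _; set v := count _ _.
  by rewrite /N; lia.
rewrite -(count_predC (predU a b)) -[X in (X < _)%N]addn0 ltn_add2l -has_count.
move=> /hasP[x xN /=]; rewrite negb_or /a /b -!leqNgt -/K => /andP[Ax Bx].
have xN1 : (x <= N)%N by exact: (allP sN).
have : `|(A * B).[x%:Z]| <= N.+1%:R * (pheight (A * B))%:Z * N.+1%:Z ^+ N.+1.
  apply: horner_norm_le => //.
  - rewrite (leq_trans (size_polyMleq _ _))// (leq_trans (leq_pred _))// leqW//.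
    by rewrite /N mul2n -addnn leq_add.
  - by move=> i; rewrite -abszE lez_nat coef_le_pheight.
  - by rewrite ger0_norm// lez_nat leqW.
rewrite hornerM normrM -!abszE natz -rmorphXn /= -!PoszM lez_nat.
move=> le; apply: leq_trans (leq_mul Ax Bx) _.
rewrite mulnACA -[leqRHS]mulnA leq_mul2l; apply/orP; right.
apply: leq_trans le _; lia.
Qed.

(** * Resultants *)

Lemma det_norm_le (K : numDomainType) (n : nat) (A : 'M[K]_n) (b : 'I_n -> K) :
  (forall i j, `|A i j| <= b i) -> `|\det A| <= n`!%:R * \prod_i b i.
Proof.
move=> Ab; rewrite /determinant (le_trans (ler_norm_sum _ _ _))//.
rewrite -card_Sn mulr_natl -sumr_const.
apply: ler_sum => s _; rewrite normrM normrX normrN1 expr1n mul1r normr_prod.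
by apply: ler_prod => i _; rewrite normr_ge0 Ab.
Qed.

(** Deleting row [i0] removes the factor [b i0]; this saves one height factor in each term of the
    resultant bound. *)
Lemma cofactor_norm_le (K : numFieldType) (n : nat) (A : 'M[K]_n) (b : 'I_n -> K)
    (i0 j0 : 'I_n) :
  (forall i, 0 < b i) -> (forall i j, `|A i j| <= b i) ->
  `|cofactor A i0 j0| <= n`!%:R * (\prod_i b i) / b i0.
Proof.
move=> b0 Ab; rewrite /cofactor normrM normrX normrN1 expr1n mul1r.
have := @det_norm_le _ _ (row' i0 (col' j0 A)) (fun k => b (lift i0 k)).
move=> /(_ _)/le_trans; apply; first by move=> i j; rewrite !mxE.
rewrite (bigD1_ord i0)//= mulrCA [leRHS]mulrC mulKf ?gt_eqF//.
rewrite ler_pM2r ?prodr_gt0// ler_nat; case: n {A Ab b b0 j0} i0 => [[]//|n] _ /=.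
by rewrite factS leq_pmull.
Qed.

(** The Sylvester matrix times the column of powers of xi has entries xi^k P(xi) or xi^k Q(xi).
    Since the first power is 1, Cramer's rule expresses the resultant, a nonzero integer, through
    these entries and the cofactors of the first column. *)
Lemma resultant_norm_ge (R : realFieldType) (xi X : R) (P Q : {poly int})
    (p q : nat) :
  size P = p.+1 -> size Q = q.+1 -> (0 < p)%N -> (0 < q)%N ->
  resultant P Q != 0 -> 1 <= X -> `|xi| <= X ->
  1 <= (q + p)`!%:R * (q + p)%:R * X ^+ (q + p) *
    ((pheight P)%:R ^+ q * (pheight Q)%:R ^+ p) *
    (`|(map_poly intr P).[xi]| / (pheight P)%:R +
     `|(map_poly intr Q).[xi]| / (pheight Q)%:R).
Proof.
move=> sPE sQE p_gt0 q_gt0 PQ0 X1 xiX.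
have sP : (1 < size P)%N by rewrite sPE.
have sQ : (1 < size Q)%N by rewrite sQE.
have pE : p = (size P).-1 by rewrite sPE.
have qE : q = (size Q).-1 by rewrite sQE.
(* The dimension of [Sylvester_mx] is stated with [(size P).-1] and [(size Q).-1], so p and q are
   replaced by these. *)
move: sPE sQE; rewrite {p}pE {q}qE in p_gt0 q_gt0 * => _ _.
set p := (size P).-1; set q := (size Q).-1.
have P0 : P != 0 by rewrite -size_poly_gt0 (ltn_trans _ sP).
have Q0 : Q != 0 by rewrite -size_poly_gt0 (ltn_trans _ sQ).
have d0 : (0 < q + p)%N by rewrite addn_gt0 /p -(subnKC sP) orbT.
pose S : 'M[R]_(q + p) := map_mx intr (Sylvester_mx P Q).
have detS : \det S = (resultant P Q)%:~R by rewrite det_map_mx.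
have detS1 : 1 <= `|\det S|.
  rewrite detS -intr_norm -[1]/(1%:~R) ler_int.
  by move: PQ0; rewrite -normr_gt0; set r := `|_|; lia.
pose hP : R := (pheight P)%:R; pose hQ : R := (pheight Q)%:R.
have hP0 : 0 < hP by rewrite ltr0n pheight_gt0.
have hQ0 : 0 < hQ by rewrite ltr0n pheight_gt0.
pose b (i : 'I_(q + p)) := match fintype.split i with inl _ => hP | inr _ => hQ end.
have b0 i : 0 < b i by rewrite /b; case: fintype.split.
have Sb i j : `|S i j| <= b i.
  have coef_le (r : {poly int}) k (c : bool) : `|(r`_k *+ c)%:~R| <= (pheight r)%:R :> R.
    case: c; last by rewrite mulr0n normr0.
    by rewrite -intr_norm -abszE -pmulrn ler_nat coef_le_pheight.
  by rewrite mxE Sylvester_mxE /b; case: (fintype.split i).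
pose v : 'cV[R]_(q + p) := S *m \col_j xi ^+ j.
pose N (i : 'I_(q + p)) := match fintype.split i with
  inl _ => `|(map_poly intr P).[xi]| | inr _ => `|(map_poly intr Q).[xi]| end.
have vN i : `|v i 0| <= X ^+ (q + p) * N i.
  have horner_shift (r : {poly int}) (k : nat) : (k + size r <= q + p)%N ->
      \sum_(j < q + p) (r`_(j - k) *+ (k <= j))%:~R * xi ^+ j =
      xi ^+ k * (map_poly intr r).[xi].
    move=> kr; rewrite -hornerXn -hornerM -(map_polyXn intr) -rmorphM /=.
    rewrite (@horner_coef_wide _ (q + p)); last first.
      rewrite (leq_trans (size_poly _ _))// mulrC (leq_trans (size_polyMleq _ _))//.
      by rewrite size_polyXn addnS /= addnC.
    apply: eq_bigr => j _; rewrite coef_map coefXnM /= ltnNge if_neg -mulrb.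
    by [].
  rewrite mxE; under eq_bigr do rewrite [S _ _]mxE Sylvester_mxE mxE.
  rewrite /N; case: (fintype.split i) => k.
    rewrite horner_shift; last first.
      rewrite -(ltn_predK sP) -/p -addSnnS leq_add2r; exact: ltn_ord.
    rewrite normrM ler_wpM2r// normrX.
    apply: (@le_trans _ _ (X ^+ k)).
      by rewrite lerXn2r ?nnegrE// (le_trans _ xiX).
    by rewrite ler_weXn2l// (leq_trans (ltnW (ltn_ord k)))// leq_addr.
  rewrite horner_shift; last first.
    rewrite -(ltn_predK sQ) -/q -addSnnS addnC leq_add2l; exact: ltn_ord.
  rewrite normrM ler_wpM2r// normrX.
  apply: (@le_trans _ _ (X ^+ k)).
    by rewrite lerXn2r ?nnegrE// (le_trans _ xiX).
  by rewrite ler_weXn2l// (leq_trans (ltnW (ltn_ord k)))// leq_addl.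
have detE : \det S = \sum_i cofactor S i (Ordinal d0) * v i 0.
  have : (\adj S *m v) (Ordinal d0) 0 = \det S.
    by rewrite mulmxA mul_adj_mx mul_scalar_mx !mxE expr0 mulr1.
  by rewrite mxE => <-; apply: eq_bigr => i _; rewrite mxE.
have prodb : \prod_i b i = hP ^+ q * hQ ^+ p.
  rewrite big_split_ord /=; congr (_ * _).
    rewrite (eq_bigr (fun=> hP)) ?prodr_const ?card_ord// => i _.
    by rewrite /b (unsplitK (inl i)).
  rewrite (eq_bigr (fun=> hQ)) ?prodr_const ?card_ord// => i _.
  by rewrite /b (unsplitK (inr i)).
apply: le_trans detS1 _; rewrite detE (le_trans (ler_norm_sum _ _ _))//.
set NP := `|_| / hP; set NQ := `|_| / hQ.
have NP0 : 0 <= NP by rewrite divr_ge0// ltW.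
have NQ0 : 0 <= NQ by rewrite divr_ge0// ltW.
have term i : `|cofactor S i (Ordinal d0) * v i 0| <=
    (q + p)`!%:R * X ^+ (q + p) * (hP ^+ q * hQ ^+ p) * (NP + NQ).
  rewrite normrM.
  apply: le_trans (ler_pM (normr_ge0 _) (normr_ge0 _)
    (cofactor_norm_le i (Ordinal d0) b0 Sb) (vN i)) _.
  rewrite prodb.
  have NbE : N i / b i <= NP + NQ.
    by rewrite /N /b /NP /NQ; case: (fintype.split i) => _; rewrite ?lerDl ?lerDr.
  rewrite [leLHS](_ : _ = (q + p)`!%:R * X ^+ (q + p) * (hP ^+ q * hQ ^+ p) *
    (N i / b i)); last by ring.
  rewrite ler_wpM2l// !mulr_ge0// ?exprn_ge0// ?ltW//.
  exact: lt_le_trans ltr01 X1.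
apply: le_trans (ler_sum _ (fun i _ => term i)) _.
by rewrite sumr_const card_ord -mulr_natl le_eqVlt; apply/orP; left; apply/eqP; ring.
Qed.

(** * Minimal polynomials *)

(** Clearing denominators gives integral polynomials vanishing at alpha; the primitive part of one
    of least size qualifies. *)
Lemma is_minpolyZ_ex (R : realType) (alpha : R[i]%C) :
  algebraicOver (ratr : rat -> R[i]%C) alpha ->
  exists P, is_minpolyZ alpha P.
Proof.
move=> [p p0 rp].
have ratint (q : {poly int}) :
    map_poly ratr (map_poly intr q : {poly rat}) = map_poly intr q :> {poly R[i]%C}.
  by rewrite -map_poly_comp; apply: eq_map_poly => z /=; rewrite ratr_int.
pose ok (k : nat) := `[< exists2 q : {poly int},
  q != 0 & size q = k /\ root (map_poly intr q) alpha >].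
have /ex_minnP[k /asboolP[q q0 [sq rq]] qmin] : exists k, ok k.
  have [q [a a0 pE]] := rat_poly_scale p.
  exists (size q); apply/asboolP; exists q; last first.
    split=> //; move: rp; rewrite pE linearZ /= rootZ ?ratint//.
    by rewrite fmorph_eq0 invr_eq0 intr_eq0.
  by apply: contraNneq p0 => q0; rewrite pE q0 rmorph0 scaler0.
exists (zprimitive q); split.
- by rewrite zcontents_primitive q0.
- move: rq; rewrite {1}[q]zpolyEprim linearZ /= rootZ//.
  by rewrite intr_eq0 zcontents_eq0.
- move=> r r0 rr; rewrite size_zprimitive sq; apply: qmin.
  by apply/asboolP; exists r.
Qed.

Lemma minpolyZP (R : realType) (alpha : R[i]%C) :
  algebraicOver (ratr : rat -> R[i]%C) alpha -> is_minpolyZ alpha (minpolyZ alpha).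
Proof. by move=> /is_minpolyZ_ex; exact: xgetPex. Qed.

Lemma zcontents1_neq0 (P : {poly int}) : zcontents P = 1 -> P != 0.
Proof. by move=> P1; rewrite -zcontents_eq0 P1. Qed.

Lemma is_minpolyZ_size (R : realType) (alpha : R[i]%C) Q :
  is_minpolyZ alpha Q -> (1 < size Q)%N.
Proof.
move=> [/zcontents1_neq0 Q0 rQ _].
have Q0' : map_poly intr Q != 0 :> {poly R[i]%C}.
  by rewrite map_poly_eq0_id0 ?intr_eq0 ?lead_coef_eq0.
have := root_size_gt1 Q0' rQ.
by rewrite size_map_poly_id0// intr_eq0 lead_coef_eq0.
Qed.

(** A zero resultant gives a common factor G of positive degree, and Q = G S over the integers once
    G is made primitive. By minimality alpha is not a root of the smaller factor S, so it is a root
    of G, and G has the size of Q. *)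
Lemma minpolyZ_dvdp (R : realType) (alpha : R[i]%C) (P Q : {poly int}) :
  is_minpolyZ alpha Q -> P != 0 -> resultant P Q = 0 -> exists S, P = Q * S.
Proof.
move=> [Q1 rQ Qmin] P0 /eqP; rewrite resultant_eq0 => sG.
have Q0 := zcontents1_neq0 Q1.
have QE : zprimitive Q = Q by rewrite {2}[Q]zpolyEprim Q1 scale1r.
set G := gcdp P Q in sG.
have G0 : G != 0 by rewrite -size_poly_gt0 (ltn_trans _ sG).
have /dvdpP_int[S QS] : G %| Q by exact: dvdp_gcdr.
have S0 : S != 0 by apply: contraNneq Q0 => S0; rewrite QS S0 mulr0.
move: rQ; rewrite {1}QS rmorphM /= rootM => /orP[rG|rS]; last first.
  have := Qmin _ S0 rS; rewrite QS size_mul ?zprimitive_eq0// size_zprimitive.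
  by move: sG; case: (size G) => [//|[//|k]] _; rewrite !addSn /= ltnNge leq_addl.
have GQ : (size Q <= size G)%N.
  by rewrite -(size_zprimitive G) Qmin ?zprimitive_eq0.
have QP : Q %| P.
  have /eqp_dvdl <- : G %= Q; last exact: dvdp_gcdl.
  by rewrite -dvdp_size_eqp ?dvdp_gcdr// eqn_leq GQ dvdp_leq// dvdp_gcdr.
by have [S' PE] := dvdpP_int QP; exists S'; rewrite -QE.
Qed.

(* Irreducibility over Q, phrased with integral factors. *)
Definition zirreducible (P : {poly int}) :=
  forall A B : {poly int}, P = A * B -> (size A <= 1)%N \/ (size B <= 1)%N.

Lemma minpolyZ_unique (R : realType) (alpha : R[i]%C) (P Q : {poly int}) :
  is_minpolyZ alpha Q -> zirreducible P -> zcontents P = 1 ->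
  resultant P Q = 0 -> P = Q.
Proof.
move=> mQ irrP P1 rPQ; have P0 := zcontents1_neq0 P1.
have [S PE] := minpolyZ_dvdp mQ P0 rPQ.
have [|sS] := irrP _ _ PE; first by rewrite leqNgt (is_minpolyZ_size mQ).
have [Q1 _ _] := mQ.
move: PE; rewrite (size1_polyC sS) mulrC mul_polyC => PE.
by move: P1; rewrite PE zcontentsZ Q1 mulr1 => ->; rewrite scale1r.
Qed.

Lemma transcendental_horner (R : realType) (xi : R) (P : {poly int}) :
  transcendental xi -> P != 0 -> 0 < `|(map_poly intr P).[xi]|.
Proof.
move=> xi_tr P0; rewrite normr_gt0; apply/negP => /eqP Pxi; apply: xi_tr.
exists (map_poly intr P : {poly rat}).
  by rewrite map_poly_eq0_id0 ?intr_eq0 ?lead_coef_eq0.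
rewrite -map_poly_comp (eq_map_poly (g := intr)) ?rootE ?Pxi// => z /=.
by rewrite ratr_int.
Qed.

Lemma horner_dist_le (K : numDomainType) (p : {poly K}) (k : nat) (h X x y : K) :
  (size p <= k)%N -> (forall i, `|p`_i| <= h) -> 1 <= X ->
  `|x| <= X -> `|y| <= X ->
  `|p.[x] - p.[y]| <= k%:R * k%:R * X ^+ k * h * `|x - y|.
Proof.
move=> pk ph X1 xX yX; have h0 : 0 <= h := le_trans (normr_ge0 _) (ph 0%N).
have X0 : 0 <= X := le_trans ler01 X1.
rewrite !(horner_coef_wide _ pk) -sumrB (le_trans (ler_norm_sum _ _ _))//.
rewrite -!mulrA mulr_natl -[X in _ *+ X](card_ord k) -sumr_const.
apply: ler_sum => i _; rewrite -mulrBr normrM subrXX normrM.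
rewrite [leRHS](_ : _ = h * (`|x - y| * (k%:R * X ^+ k))); last by ring.
rewrite ler_pM//; rewrite ler_wpM2l//.
apply: le_trans (ler_norm_sum _ _ _) _.
apply: (@le_trans _ _ (\sum_(j < i) X ^+ k)).
  apply: ler_sum => j _; rewrite normrM !normrX.
  apply: (@le_trans _ _ (X ^+ (i.-1 - j) * X ^+ j)).
    by rewrite ler_pM ?exprn_ge0// lerXn2r ?nnegrE.
  by rewrite -exprD ler_weXn2l//; have := ltn_ord i; have := ltn_ord j; lia.
by rewrite sumr_const card_ord mulr_natl ler_wpMn2l ?exprn_ge0// ltnW.
Qed.

(** A mean value estimate between xi and alpha, where Q(alpha) = 0. It takes place in [R[i]] as
    alpha may be complex; a distance at most 1 gives |alpha| <= |xi| + 1. *)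
Lemma minpolyZ_eval_le (R : realType) (xi : R) (alpha : R[i]%C) (Q : {poly int}) k :
  (size Q <= k)%N -> root (map_poly intr Q) alpha -> adist xi alpha <= 1 ->
  `|(map_poly intr Q).[xi]| <=
  k%:R * k%:R * (`|xi| + 1) ^+ k * (pheight Q)%:R * adist xi alpha.
Proof.
move=> sQ rQ d1; set X := `|xi| + 1.
have normE (z : R[i]%C) : `|z| = (Normc.normc z)%:C%C by [].
have xiE : `|xi%:C%C| = `|xi|%:C%C :> R[i]%C.
  by rewrite normE /= expr0n addr0 sqrtr_sqr.
have evE : (map_poly intr Q).[xi%:C%C] = ((map_poly intr Q).[xi])%:C%C :> R[i]%C.
  rewrite -horner_map -map_poly_comp; congr horner.
  by apply: eq_map_poly => z /=; rewrite rmorph_int.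
have X1 : 1 <= X by rewrite lerDr.
rewrite -lecR.
have -> : `|(map_poly intr Q).[xi]|%:C%C = `|(map_poly intr Q).[xi%:C%C] -
    (map_poly intr Q).[alpha]| :> R[i]%C.
  by rewrite (eqP rQ) subr0 evE normE /= expr0n addr0 sqrtr_sqr.
rewrite !rmorphM rmorphXn !rmorph_nat /=.
have -> : (adist xi alpha)%:C%C = `|xi%:C%C - alpha| by [].
apply: horner_dist_le.
- by rewrite (leq_trans (size_poly _ _)).
- move=> i; rewrite coef_map /= -intr_norm -abszE -pmulrn.
  by rewrite ler_nat coef_le_pheight.
- by rewrite -[1]/(1%:C%C) lecR.
- by rewrite xiE lecR lerDl.
- have -> : alpha = xi%:C%C - (xi%:C%C - alpha) by rewrite opprB addrC subrK.
  by rewrite (le_trans (ler_normB _ _))// xiE [X in _ + X]normE -rmorphD lecR lerD2l.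
Qed.

(** * Approximation by irreducible polynomials *)

Lemma finite_set_pheight (k b : nat) :
  finite_set [set P : {poly int} | (size P <= k)%N /\ (pheight P <= b)%N].
Proof.
pose F (f : {ffun 'I_k -> 'I_(b + b).+1}) : {poly int} :=
  \poly_(i < k) (if insub i is Some j then (f j)%:Z - b%:Z else 0).
apply: (@sub_finite_set _ _ (F @` [set: {ffun 'I_k -> 'I_(b + b).+1}])).
  move=> P [sP /pheight_leP Pb].
  exists [ffun j : 'I_k => inord (absz (P`_j + b%:Z)%R)] => //.
  apply/polyP => i; rewrite coef_poly; case: ltnP => ik; last first.
    by rewrite nth_default// (leq_trans sP).
  have := Pb i; rewrite (insubT (fun i => (i < k)%N) ik) /= ffunE => Pib.
  rewrite inordK /=; lia.
by apply: finite_image; exact: finite_finset.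
Qed.

Lemma finite_set_gt0_lbound (R : realType) (T : choiceType) (A : set T) (f : T -> R) :
  finite_set A -> (forall x, A x -> 0 < f x) ->
  exists2 c, 0 < c & forall x, A x -> c <= f x.
Proof.
move=> /finite_seqP[s ->] {A}; elim: s => [|x s IHs] f0.
  by exists 1.
have [|c c0 cs] := IHs; first by move=> y /= ys; apply: f0; rewrite /= inE ys orbT.
exists (Num.min c (f x)).
  by rewrite lt_min c0 f0//= mem_head.
move=> y /=; rewrite inE => /predU1P[->|ys]; first by rewrite ge_min lexx orbT.
by rewrite ge_min cs.
Qed.

Lemma powRN_le1 (R : realType) (h w : R) : 1 <= h -> 0 <= w -> h `^ (- w) <= 1.
Proof. by move=> h1 w0; rewrite -(powRr0 h) ler_powR// oppr_le0. Qed.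

Lemma ler_powRN (R : realType) (x y w : R) :
  0 < x -> x <= y -> 0 <= w -> y `^ (- w) <= x `^ (- w).
Proof.
move=> x0 xy w0; have y0 := lt_le_trans x0 xy.
rewrite !powRN lef_pV2 ?posrE ?powR_gt0//.
by rewrite ge0_ler_powR ?nnegrE ?(ltW x0) ?(ltW y0).
Qed.

Section IrreducibleApproximations.
Variables (R : realType) (xi : R).
Hypothesis xi_tr : transcendental xi.

Local Notation ev P := ((map_poly intr P).[xi] : R).
Local Notation ht P := ((pheight P)%:R : R).

Lemma ht_ge1 (P : {poly int}) : P != 0 -> 1 <= ht P.
Proof. by move=> P0; rewrite ler1n pheight_gt0. Qed.

(** A lower bound c h^-w passes from two factors to their product, up to constants, because H(A)
    H(B) <= C H(AB) by Gelfond's inequality. Induction on the size thus reduces to irreducible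
    polynomials. *)
Lemma eval_lbound_of_irreducible (k : nat) (w c0 : R) : 0 <= w -> 0 < c0 ->
  (forall P, zirreducible P -> zcontents P = 1 -> (1 < size P)%N ->
    (size P <= k)%N -> c0 * ht P `^ (- w) <= `|ev P|) ->
  exists2 c : R, 0 < c & forall P : {poly int}, P != 0 -> (size P <= k)%N ->
    c * ht P `^ (- w) <= `|ev P|.
Proof.
move=> w0 c00 irr; have [C C0 gelfond] := pheightM_ge k.
suff: forall d, (d <= k)%N -> exists2 c : R, 0 < c & forall P : {poly int}, P != 0 ->
    (size P <= d)%N -> c * ht P `^ (- w) <= `|ev P| by apply.
elim=> [_|d IHd dk].
  by exists 1 => // P; rewrite leqn0 size_poly_eq0 => /negPf->.
have [c c1 IH] := IHd (ltnW dk).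
pose D : R := c * c * C%:R `^ (- w).
have D0 : 0 < D by rewrite !mulr_gt0// powR_gt0// ltr0n.
exists (Num.min 1 (Num.min c0 D)); first by rewrite !lt_min ltr01 c00 D0.
set e := Num.min _ _.
have e1 : e <= 1 by rewrite ge_min lexx.
have ec : e <= c0 by rewrite !ge_min lexx orbT.
have eD : e <= D by rewrite !ge_min lexx !orbT.
have e0 : 0 <= e by rewrite !le_min ler01 !ltW.
(* Passing to the primitive part raises neither |P(xi)| nor the height, and a lower height only
   strengthens the bound since w >= 0. *)
suff prim P : zcontents P = 1 -> (size P <= d.+1)%N ->
    e * ht P `^ (- w) <= `|ev P|.
  move=> P P0 sP; have z0 : zcontents P != 0 by rewrite zcontents_eq0.
  rewrite [X in ev X]zpolyEprim map_polyZ hornerZ normrM.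
  apply: (@le_trans _ _ `|ev (zprimitive P)|); last first.
    rewrite ler_peMl// -intr_norm -[1]/(1%:~R) ler_int.
    by move: z0; rewrite -normr_gt0; set r := `|_|; lia.
  apply: le_trans (prim _ _ _); rewrite ?zcontents_primitive ?P0 ?size_zprimitive//.
  rewrite ler_wpM2l// ler_powRN//.
    by rewrite ltr0n pheight_gt0 ?zprimitive_eq0.
  by rewrite ler_nat [X in (_ <= pheight X)%N]zpolyEprim pheightZ_ge.
move=> P1 sP; have P0 := zcontents1_neq0 P1.
have [sP1|sP1] := leqP (size P) 1.
  rewrite (size1_polyC sP1) map_polyC hornerC.
  apply: (@le_trans _ _ 1).
    rewrite -[leRHS]mulr1 ler_pM ?powR_ge0// powRN_le1// ler1n pheight_gt0//.
    by rewrite -(size1_polyC sP1).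
  rewrite -intr_norm -[1]/(1%:~R) ler_int.
  have : P`_0 != 0 by rewrite -polyC_eq0 -(size1_polyC sP1).
  by rewrite -normr_gt0; set r := `|_|; lia.
have [irrP|] := pselect (zirreducible P).
  apply: le_trans (irr P irrP P1 sP1 (leq_trans sP dk)).
  by rewrite ler_wpM2r ?powR_ge0.
move=> /existsNP[A] /existsNP[B] /not_implyP[PE] /not_orP[].
move=> /negP; rewrite -ltnNge => sA /negP; rewrite -ltnNge => sB.
have A0 : A != 0 by rewrite -size_poly_gt0 (ltn_trans _ sA).
have B0 : B != 0 by rewrite -size_poly_gt0 (ltn_trans _ sB).
have sAB : (size A <= d)%N /\ (size B <= d)%N.
  move: sP sA sB; rewrite PE size_mul//.
  by move: (size A) (size B) => a b; lia.
rewrite PE rmorphM hornerM normrM -PE.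
apply: le_trans (ler_pM _ _ (IH A A0 sAB.1) (IH B B0 sAB.2));
  rewrite ?mulr_ge0 ?powR_ge0 ?(ltW c1)//.
rewrite mulrACA -powRM//.
apply: (@le_trans _ _ (D * ht P `^ (- w))); first by rewrite ler_wpM2r ?powR_ge0.
rewrite /D -mulrA ler_wpM2l ?mulr_ge0 ?(ltW c1)// -powRM//.
rewrite ler_powRN//; first by rewrite mulr_gt0// ltr0n pheight_gt0.
rewrite -!natrM ler_nat PE gelfond//.
- by rewrite (leq_trans sAB.1)// ltnW.
- by rewrite (leq_trans sAB.2)// ltnW.
Qed.

(** If no such P existed beyond height b, all irreducible polynomials, hence all nonzero ones of
    degree at most m, would satisfy |P(xi)| >= c h^-w. As w < w', those with |P(xi)| <= h^-w' would
    have bounded height and be finite in number. *)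
Lemma irreducible_approximation (m : nat) (w w' : R) : 0 <= w -> w < w' ->
  infinite_set [set P : {poly int} | ((size P).-1 <= m)%N /\
    0 < `|ev P| <= ht P `^ (- w')] ->
  forall b : nat, exists P, [/\ zirreducible P, zcontents P = 1,
    (1 < size P <= m.+1)%N, (b < pheight P)%N & `|ev P| <= ht P `^ (- w)].
Proof.
move=> w0 ww' infP b; apply: contrapT => noP.
have [c1 c10 c1P] : exists2 c : R, 0 < c & forall P : {poly int},
    ([set P : {poly int} | (size P <= m.+1)%N /\ (pheight P <= b)%N] `\ 0) P ->
    c <= `|ev P|.
  apply: finite_set_gt0_lbound; first exact/finite_setD/finite_set_pheight.
  by move=> P [_ /eqP P0]; exact: transcendental_horner.
have [c c0 cP] : exists2 c : R, 0 < c & forall P : {poly int}, P != 0 ->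
    (size P <= m.+1)%N -> c * ht P `^ (- w) <= `|ev P|.
  apply: (@eval_lbound_of_irreducible _ _ (Num.min 1 c1)) => //.
    by rewrite lt_min ltr01.
  move=> P irrP P1 sP1 sPm; have P0 := zcontents1_neq0 P1.
  have [hPb|hPb] := leqP (pheight P) b.
    apply: (@le_trans _ _ c1); last by apply: c1P; split => //; exact/eqP.
    rewrite -[leRHS]mulr1 ler_pM ?powR_ge0 ?le_min ?ler01 ?(ltW c10)//.
      by rewrite ge_min lexx orbT.
    by rewrite powRN_le1// ht_ge1.
  apply: (@le_trans _ _ (ht P `^ (- w))).
    by rewrite ler_piMl ?powR_ge0// ge_min lexx.
  rewrite leNgt; apply/negP => /ltW evP; apply: noP; exists P; split => //.
  by rewrite sP1.
apply: infP.
(* From c h^-w <= h^-w' follows h <= y. *)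
pose y := c^-1 `^ (w' - w)^-1.
apply: sub_finite_set (finite_set_pheight m.+1 (Num.bound y)).
move=> P [sPm /andP[evP0 evP]].
have P0 : P != 0.
  by apply: contraTneq evP0 => ->; rewrite rmorph0 horner0 normr0 ltxx.
have sP : (size P <= m.+1)%N by move: sPm; case: (size P).
split=> //.
have hP0 : 0 < ht P by rewrite ltr0n pheight_gt0.
have d0 : 0 < w' - w by rewrite subr_gt0.
suff hy : ht P <= y.
  have := archi_boundP (powR_ge0 c^-1 (w' - w)^-1).
  by move=> /(le_lt_trans hy)/ltW; rewrite ler_nat.
have : ht P `^ (w' - w) <= c^-1.
  have := le_trans (cP P P0 sP) evP.
  have hw' := powR_gt0 w' hP0.
  rewrite powRB ?gt_eqF ?implybT// !powRN -(ler_pM2l hw') divff ?gt_eqF//.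
  by rewrite mulrCA mulrC -ler_pdivlMr// mul1r.
move=> h.
have := @ge0_ler_powR _ (w' - w)^-1 _ _ _ _ _ h.
rewrite -powRrM divff ?gt_eqF// powRr1 ?(ltW hP0)//; apply.
- by rewrite invr_ge0 ltW.
- by rewrite nnegrE powR_ge0.
- by rewrite nnegrE invr_ge0 ltW.
Qed.

End IrreducibleApproximations.

(** * Elementary bounds on the exponents *)

Lemma near_pinfty_powR_gt (R : realType) (e K : R) : 0 < e ->
  \forall H \near +oo, K < H `^ e.
Proof.
move=> e0; near=> H.
have en0 : e != 0 by rewrite gt_eqF.
have K1 : 0 < Num.max K 1 by rewrite lt_max ltr01 orbT.
apply: (@le_lt_trans _ _ (Num.max K 1)); first by rewrite le_max lexx.
rewrite -[ltLHS]powRr1 ?(ltW K1)// -(mulVf en0) powRrM.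
have HK : Num.max K 1 `^ e^-1 < H by near: H; exact: nbhs_pinfty_gt.
by rewrite gt0_ltr_powR ?nnegrE ?powR_ge0// (le_trans (powR_ge0 _ _) (ltW HK)).
Unshelve. all: by end_near. Qed.

Section Exponents.
Variables (R : realType) (xi : R).
Hypothesis xi_tr : transcendental xi.

Local Notation ev P := ((map_poly intr P).[xi] : R).
Local Notation ht P := ((pheight P)%:R : R).

(** The set defining [what_star_exp n xi] consists of exactly these v. *)
Definition uniform_star (n : nat) (v : R) : Prop :=
  \forall H \near +oo, exists alpha : R[i]%C,
    [/\ algebraic_deg_le n alpha,
        0 < adist xi alpha <= (aheight alpha)%:R^-1 * H `^ (- v) &
        (aheight alpha)%:R <= H].

Lemma aheight_ge1 (alpha : R[i]%C) :
  algebraicOver (ratr : rat -> R[i]%C) alpha -> 1 <= (aheight alpha)%:R :> R.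
Proof. by move=> /minpolyZP[/zcontents1_neq0 Q0 _ _]; exact: ht_ge1. Qed.

(** The factor 1/H(alpha) in the distance cancels the height of Q in the estimate of |Q(xi)|. *)
Lemma uniform_star_poly (n : nat) (v : R) : 0 < v -> uniform_star n v ->
  exists2 C : R, 0 < C & \forall H \near +oo, exists alpha : R[i]%C, exists Q,
    [/\ is_minpolyZ alpha Q, (size Q <= n.+1)%N,
        `|ev Q| <= C * H `^ (- v) & ht Q <= H].
Proof.
move=> v0 nv; exists (n.+1%:R * n.+1%:R * (`|xi| + 1) ^+ n.+1).
  by rewrite !mulr_gt0// exprn_gt0// ltr_wpDl.
near=> H.
have H1 : 1 <= H by near: H; exact: nbhs_pinfty_ge.
have [alpha [[alg_alpha deg_alpha] /andP[_ dist] haH]] : exists alpha : R[i]%C,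
    [/\ algebraic_deg_le n alpha,
        0 < adist xi alpha <= (aheight alpha)%:R^-1 * H `^ (- v) &
        (aheight alpha)%:R <= H] by near: H.
have mQ := minpolyZP alg_alpha; set Q := minpolyZ alpha in mQ.
have h1 := aheight_ge1 alg_alpha; have h0 := lt_le_trans ltr01 h1.
have Hv1 : H `^ (- v) <= 1 by rewrite powRN_le1// ltW.
have sQ : (size Q <= n.+1)%N by move: deg_alpha; rewrite -/Q; case: (size Q).
have [_ rQ _] := mQ.
exists alpha, Q; split=> //.
have d1 : adist xi alpha <= 1.
  rewrite (le_trans dist)// -[leRHS]mulr1 ler_pM ?powR_ge0 ?invr_ge0//.
  by rewrite invf_le1.
apply: le_trans (minpolyZ_eval_le sQ rQ d1) _.
rewrite -mulrA ler_wpM2l//.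
by rewrite -ler_pdivlMl.
Unshelve. all: by end_near. Qed.

Lemma lee_of_lt_nonneg (v : R) (y : \bar R) : 0 < v ->
  (forall u : R, 0 < u < v -> (u%:E <= y)%E) -> (v%:E <= y)%E.
Proof.
move=> v0 uy; rewrite leNgt; apply/negP; case: y uy => [y| |] uy; last 2 first.
- by rewrite ltNge leey.
- have : ((v / 2)%:E <= (-oo : \bar R))%E by apply: uy; lra.
  by rewrite leeNy_eq.
rewrite lte_fin => yv.
pose u := (Num.max y 0 + v) / 2.
have yu : y < u /\ 0 < u < v.
  have : y <= Num.max y 0 by rewrite le_max lexx.
  have : 0 <= Num.max y 0 by rewrite le_max lexx orbT.
  have : Num.max y 0 < v by rewrite gt_max yv.
  rewrite /u; lra.
have := uy u yu.2; rewrite lee_fin; lra.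
Qed.

(** The minimal polynomials found at the levels H have nonzero values tending to 0, so they form an
    infinite set, and H(Q) <= H turns H^-u into H(Q)^-u. Taking u < v absorbs the constant C. *)
Lemma uniform_star_le_w (n m : nat) (v : R) : (n <= m)%N -> 0 < v ->
  uniform_star n v -> (v%:E <= w_exp m xi)%E.
Proof.
move=> nm v0 nv; have [C C0 nearQ] := uniform_star_poly v0 nv.
apply: lee_of_lt_nonneg => // u /andP[u0 uv].
apply: ereal_sup_ubound; exists u => //=.
set A := (X in infinite_set X) => finA.
have [c c0 cA] : exists2 c : R, 0 < c & forall P, A P -> c <= `|ev P|.
  by apply: finite_set_gt0_lbound => // P [_ /andP[]].
suff : \forall H \near (+oo : set_system R), False.
  by move=> /filter_ex[].
near=> H.
have H1 : 1 <= H by near: H; exact: nbhs_pinfty_ge.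
have [alpha [Q [mQ sQ evQ hQ]]] : exists alpha : R[i]%C, exists Q,
    [/\ is_minpolyZ alpha Q, (size Q <= n.+1)%N,
        `|ev Q| <= C * H `^ (- v) & ht Q <= H] by near: H.
have [/zcontents1_neq0 Q0 _ _] := mQ.
have H0 : 0 < H := lt_le_trans ltr01 H1.
have CHu : C * H `^ (- v) <= H `^ (- u).
  have Cle : C <= H `^ (v - u).
    by apply: ltW; near: H; apply: near_pinfty_powR_gt; rewrite subr_gt0.
  have -> : - u = (v - u) - v by ring.
  rewrite (powRD (r := v - u)) ?(gt_eqF H0) ?implybT//.
  by rewrite ler_wpM2r ?powR_ge0.
have CHc : C * H `^ (- v) < c.
  have : C / c < H `^ v by near: H; exact: near_pinfty_powR_gt.
  by rewrite powRN ltr_pdivrMr// ltr_pdivrMr ?powR_gt0// mulrC.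
have AQ : A Q.
  split; first by rewrite (leq_trans _ nm)// -ltnS (leq_trans _ sQ)//;
    case: (size Q) (is_minpolyZ_size mQ).
  rewrite transcendental_horner//= (le_trans evQ)// (le_trans CHu)//.
  by rewrite ler_powRN// ?ltW// (lt_le_trans ltr01)// ht_ge1.
by have := lt_le_trans (le_lt_trans evQ CHc) (cA Q AQ); rewrite ltxx.
Unshelve. all: by end_near. Qed.

(** Here no constant is lost, so v itself is admissible: H(alpha) <= H gives H(alpha)^-1 H^-v <=
    H(alpha)^(-v-1), and the distances tend to 0 without vanishing. *)
Lemma uniform_star_le_wstar (n : nat) (v : R) : 0 < v ->
  uniform_star n v -> (v%:E <= wstar_exp n xi)%E.
Proof.
move=> v0 nv; apply: ereal_sup_ubound; exists v => //=.
set A := (X in infinite_set X) => finA.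
have [c c0 cA] : exists2 c : R, 0 < c & forall alpha, A alpha -> c <= adist xi alpha.
  by apply: finite_set_gt0_lbound => // P [_ /andP[]].
suff : \forall H \near (+oo : set_system R), False.
  by move=> /filter_ex[].
near=> H.
have H1 : 1 <= H by near: H; exact: nbhs_pinfty_ge.
have [alpha [deg_alpha /andP[d0 dist] haH]] : exists alpha : R[i]%C,
    [/\ algebraic_deg_le n alpha,
        0 < adist xi alpha <= (aheight alpha)%:R^-1 * H `^ (- v) &
        (aheight alpha)%:R <= H] by near: H.
have H0 : 0 < H := lt_le_trans ltr01 H1.
have h1 := aheight_ge1 deg_alpha.1; have h0 := lt_le_trans ltr01 h1.
have Hc : H `^ (- v) < c.
  have : c^-1 < H `^ v by near: H; exact: near_pinfty_powR_gt.
  by rewrite powRN invf_plt ?posrE ?powR_gt0.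
have Aalpha : A alpha.
  split=> //; rewrite d0 (le_trans dist)//= addrC powRD ?(gt_eqF h0) ?implybT//.
  rewrite powR_inv1 ?(ltW h0)// ler_wpM2l ?invr_ge0 ?(ltW h0)//.
  by rewrite ler_powRN// ltW.
have : adist xi alpha <= H `^ (- v).
  by rewrite (le_trans dist)// ler_piMl ?powR_ge0// invf_le1.
by move=> /le_lt_trans/(_ Hc)/lt_le_trans/(_ (cA _ Aalpha)); rewrite ltxx.
Unshelve. all: by end_near. Qed.

(** Every negative v is admissible with the fixed number alpha = 0, since H^-v then tends to
    infinity. *)
Lemma what_star_ge0 (n : nat) : (0 < n)%N -> (0 <= what_star_exp n xi)%E.
Proof.
move=> n0.
have alg0 : algebraicOver (ratr : rat -> R[i]%C) 0.
  by exists 'X; rewrite ?polyX_eq0// map_polyX rootX.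
have xi0 : xi != 0.
  apply/eqP => xi0; apply: xi_tr; exists 'X; rewrite ?polyX_eq0//.
  by rewrite map_polyX xi0 rootX.
have h0 : 0 < (aheight (0 : R[i]%C))%:R :> R.
  exact: lt_le_trans ltr01 (aheight_ge1 alg0).
have neg v : v < 0 -> uniform_star n v.
  move=> v0; near=> H; exists 0; split.
  - split=> //; have [_ _ /(_ 'X)] := minpolyZP alg0.
    rewrite polyX_eq0 map_polyX rootX => /(_ isT (eqxx _)).
    by rewrite size_polyX; case: (size _) => [|[|[|]]].
  - have -> : adist xi 0 = `|xi|.
      by rewrite /adist subr0 /= expr0n addr0 sqrtr_sqr.
    rewrite normr_gt0 xi0 /= ler_pdivlMl// ltW//.
    by near: H; apply: near_pinfty_powR_gt; rewrite oppr_gt0.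
  - by near: H; exact: nbhs_pinfty_ge.
rewrite leNgt; apply/negP => what_lt0.
have [v v0 whatv] : exists2 v : R, v < 0 & (what_star_exp n xi < v%:E)%E.
  move: what_lt0; case: (what_star_exp n xi) => [r| |].
  - by rewrite lte_fin => r0; exists (r / 2); rewrite ?lte_fin; lra.
  - by rewrite ltNge leey.
  - by exists (-1); rewrite ?ltNyr// ltrN10.
move: whatv; rewrite ltNge => /negP; apply.
by apply: ereal_sup_ubound; exists v => //; exact: neg.
Unshelve. all: by end_near. Qed.

(** The exponent 0 is admissible: the linear polynomials a X - floor(a xi), a >= 1, take values in
    (0, 1) at xi. *)
Lemma w_exp_ge0 (m : nat) : (0 < m)%N -> (0 <= w_exp m xi)%E.
Proof.
move=> m0; apply: ereal_sup_ubound; exists 0 => //=.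
set A := (X in infinite_set X) => finA.
pose f (k : nat) : {poly int} := k.+1%:Z *: 'X - (Num.floor (k.+1%:R * xi))%:P.
have coef1 k : (f k)`_1 = k.+1%:Z.
  by rewrite coefB coefZ coefX coefC /= mulr1 subr0.
have finj : injective f.
  by move=> k l /(congr1 (fun p : {poly int} => p`_1)); rewrite !coef1 => -[].
apply: infinite_nat; rewrite -(_ : f @^-1` A = setT).
  by apply: finite_preimage => // k l _ _; exact: finj.
apply/seteqP; split => // k _ /=.
have f0 : f k != 0.
  by apply: contra_eq_neq (coef1 k) => ->; rewrite coef0.
split.
  have : (size (f k) <= 2)%N.
    rewrite (leq_trans (size_polyD _ _))// geq_max size_polyN.
    rewrite (leq_trans (size_scale_leq _ _)) ?size_polyX//=.
    by rewrite (leq_trans (size_polyC_leq1 _)).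
  by case: (size _) => [|[|[|]]].
rewrite transcendental_horner//= oppr0 powRr0.
have -> : ev (f k) = k.+1%:R * xi - (Num.floor (k.+1%:R * xi))%:~R.
  by rewrite rmorphB /= map_polyZ map_polyX map_polyC !hornerE.
set y := _ * xi; have /andP[fy1 fy2] := floor_itv y.
rewrite ger0_norm ?subr_ge0// lerBlDl ltW//.
by move: fy2; rewrite intrD.
Qed.

End Exponents.

(** * The case of a large exponent w_m *)

Section LargeExponent.
Variables (R : realType) (xi : R).
Hypothesis xi_tr : transcendental xi.

Local Notation ev P := ((map_poly intr P).[xi] : R).
Local Notation ht P := ((pheight P)%:R : R).

(** Here P and Q have degrees at most m + 1 and n + 1. Heights are at least 1, so the degrees in the
    exponents may be raised to these bounds. *)
Lemma resultant_eval_ge (m n : nat) : exists2 C : R, 0 < C &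
  forall P Q : {poly int}, (1 < size P <= m.+2)%N -> (1 < size Q <= n.+2)%N ->
  resultant P Q != 0 ->
  1 <= C * (`|ev P| * ht P ^+ n * ht Q ^+ m.+1 +
            `|ev Q| * ht P ^+ n.+1 * ht Q ^+ m).
Proof.
pose X := `|xi| + 1; pose d := (n.+1 + m.+1)%N.
have X1 : 1 <= X by rewrite lerDr.
have X0 : 0 < X := lt_le_trans ltr01 X1.
exists (d`!%:R * d%:R * X ^+ d).
  by rewrite !mulr_gt0 ?exprn_gt0// ltr0n fact_gt0.
move=> P Q /andP[sP sPm] /andP[sQ sQn] PQ0.
have P0 : P != 0 by rewrite -size_poly_gt0 (ltn_trans _ sP).
have Q0 : Q != 0 by rewrite -size_poly_gt0 (ltn_trans _ sQ).
have hP1 := @ht_ge1 R _ P0; have hQ1 := @ht_ge1 R _ Q0.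
have hP0 := lt_le_trans ltr01 hP1; have hQ0 := lt_le_trans ltr01 hQ1.
have [p sPE] : exists p, size P = p.+2.
  by exists (size P).-2; move: sP; case: (size P) => [|[]].
have [q sQE] : exists q, size Q = q.+2.
  by exists (size Q).-2; move: sQ; case: (size Q) => [|[]].
rewrite sPE !ltnS in sPm; rewrite sQE !ltnS in sQn.
have xiX : `|xi| <= X by rewrite lerDl.
have := resultant_norm_ge sPE sQE (ltn0Sn _) (ltn0Sn _) PQ0 X1 xiX.
move=> /le_trans; apply.
have -> : `|ev P| * ht P ^+ n * ht Q ^+ m.+1 + `|ev Q| * ht P ^+ n.+1 * ht Q ^+ m =
    (ht P ^+ n.+1 * ht Q ^+ m.+1) * (`|ev P| / ht P + `|ev Q| / ht Q).
  by rewrite !exprS; field; rewrite !gt_eqF.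
rewrite [leRHS]mulrA ler_wpM2r ?addr_ge0 ?divr_ge0 ?(ltW hP0) ?(ltW hQ0)//.
have qpd : (q.+1 + p.+1 <= d)%N by rewrite /d leq_add.
rewrite ler_pM ?mulr_ge0 ?exprn_ge0 ?(ltW hP0) ?(ltW hQ0) ?(ltW X0)//.
  rewrite ler_pM ?mulr_ge0 ?exprn_ge0 ?(ltW X0)// ?ler_weXn2l//.
  by rewrite ler_pM// ler_nat// leq_fact.
by rewrite ler_pM ?exprn_ge0 ?(ltW hP0) ?(ltW hQ0)// ler_weXn2l.
Qed.

(** Indices are shifted: the degrees are [m.+1] and [n.+1], so n stands for the n - 1 of the
    theorem. Sizes are compared through the logarithms L = ln h and l = ln x. *)
Lemma uniform_star_large_w (m n : nat) (v w w' : R) :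
  n%:R + m.+1%:R < w -> w < w' ->
  infinite_set [set P : {poly int} | ((size P).-1 <= m.+1)%N /\
    0 < `|ev P| <= ht P `^ (- w')] ->
  0 < v -> uniform_star xi n.+1 v ->
  v * (w - n%:R) <= m.+1%:R * w.
Proof.
move=> nmw ww' infP v0 nv; rewrite leNgt; apply/negP => vw.
have w0 : 0 <= w by rewrite ltW// (le_lt_trans _ nmw)// addr_ge0.
have [C1 C10 nearQ] := uniform_star_poly v0 nv.
have [C2 C20 resPQ] := resultant_eval_ge m n.
have [M [_ MQ]] := nearQ.
(* This value makes the first term of the resultant inequality at most 1/2. *)
pose c := (2 * C2)^-1.
have c0 : 0 < c by rewrite invr_gt0 mulr_gt0.
pose del := v * (w - n%:R) - m.+1%:R * w.
have del0 : 0 < del by rewrite subr_gt0.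
have mu0 : 0 < w - n%:R - m.+1%:R by lra.
have m0 : 0 < m.+1%:R :> R by rewrite ltr0n.
(* Three thresholds for L: the first gives H > M once H >= h, the second gives H >= h, the third the
   final contradiction. *)
pose K : R := Num.max (Num.max (ln (Num.max M 1)) (- ln c / (w - n%:R - m.+1%:R)))
  ((m.+1%:R * ln C1 - v * ln c) / del).
have [P [irrP P1 /andP[sP sPm] hPK evP]] :=
  irreducible_approximation xi_tr w0 ww' infP (Num.bound (expR K)).
have P0 := zcontents1_neq0 P1.
set x := `|ev P| in evP; set h := ht P in evP.
have x0 : 0 < x by exact: transcendental_horner.
have h1 : 1 <= h by exact: ht_ge1.
have h0 : 0 < h := lt_le_trans ltr01 h1.
pose L := ln h; pose l := ln x.
have KL : K < L.
  rewrite -[K]expRK ltr_ln ?posrE ?expR_gt0//.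
  apply: lt_trans (archi_boundP (ltW (expR_gt0 K))) _.
  by rewrite ltr_nat.
have lL : l <= - (w * L).
  by rewrite -mulNr -ln_powR ler_ln ?posrE ?powR_gt0.
have [[KM Kc] Kd] : (ln (Num.max M 1) < L /\ - ln c / (w - n%:R - m.+1%:R) < L) /\
    (m.+1%:R * ln C1 - v * ln c) / del < L.
  by move: KL; rewrite !gt_max => /andP[/andP[]].
rewrite ltr_pdivrMr// in Kc; rewrite ltr_pdivrMr// in Kd.
have L0 : 0 <= L by exact: ln_ge0.
pose lH := (ln c - l - n%:R * L) / m.+1%:R.
have lHE : m.+1%:R * lH = ln c - l - n%:R * L by rewrite /lH mulrC divfK ?gt_eqF.
(* As l <= -w L, the numerator of [lH] is at least ln c + (w - n) L, which exceeds (m + 1) L by the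
   second threshold. *)
have LlH : L <= lH.
  rewrite ler_pdivlMr//; move: lL Kc; lra.
pose H := expR lH.
have H0 : 0 < H by exact: expR_gt0.
have hH : h <= H by rewrite -[h]lnK ?posrE// ler_expR.
have HE : H ^+ m.+1 = c / (x * h ^+ n).
  rewrite -expRM_natl lHE !expRD !expRN expRM_natl !lnK ?posrE//.
  by rewrite invfM mulrA.
have MH : M < H.
  apply: le_lt_trans (_ : Num.max M 1 < _); first by rewrite le_max lexx.
  apply: lt_le_trans hH; rewrite -ltr_ln ?posrE// lt_max ltr01 orbT//.
have [alpha [Q [mQ sQ evQ hQ]]] := MQ H MH.
have sQ1 := is_minpolyZ_size mQ.
have [/zcontents1_neq0 Q0 _ _] := mQ.
have hQ0 : 0 < ht Q by rewrite ltr0n pheight_gt0.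
(* If P = Q, this is the bound on |Q(xi)|. Otherwise the first resultant term is at most 1/2, so the
   second, itself at most C1 H^-v / (2 x), is at least 1/2. *)
have xC : x <= C1 * H `^ (- v).
  have [res0|res0] := eqVneq (resultant P Q) 0.
    by rewrite /x (minpolyZ_unique mQ irrP P1 res0).
  have := resPQ P Q; rewrite sP sPm sQ1 sQ => /(_ isT isT res0).
  rewrite -/x -/h mulrDr => res1.
  have term1 : C2 * (x * h ^+ n * ht Q ^+ m.+1) <= 1 / 2.
    apply: (@le_trans _ _ (C2 * (x * h ^+ n * H ^+ m.+1))).
      rewrite ler_wpM2l ?(ltW C20)// ler_wpM2l ?mulr_ge0 ?exprn_ge0 ?(ltW x0) ?(ltW h0)//.
      by rewrite lerXn2r ?nnegrE ?(ltW H0).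
    rewrite HE /c le_eqVlt; apply/orP; left; apply/eqP; field.
    by rewrite !gt_eqF// exprn_gt0.
  have term2 : C2 * (`|ev Q| * h ^+ n.+1 * ht Q ^+ m) <=
      C1 * H `^ (- v) / (2 * x).
    apply: (@le_trans _ _ (C2 * (C1 * H `^ (- v) * (h ^+ n * H) * H ^+ m))).
      rewrite ler_wpM2l ?(ltW C20)// ler_pM ?mulr_ge0 ?exprn_ge0 ?(ltW h0)//.
        rewrite ler_pM ?exprn_ge0 ?(ltW h0)// exprSr ler_wpM2l ?exprn_ge0 ?(ltW h0)//.
      by rewrite lerXn2r ?nnegrE ?(ltW H0).
    have -> : C2 * (C1 * H `^ (- v) * (h ^+ n * H) * H ^+ m) =
      C2 * (C1 * H `^ (- v) * h ^+ n * H ^+ m.+1) by rewrite exprS; ring.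
    rewrite HE /c le_eqVlt; apply/orP; left; apply/eqP; field.
    by rewrite !gt_eqF// exprn_gt0.
  have : 1 / 2 <= C1 * H `^ (- v) / (2 * x) by lra.
  by rewrite ler_pdivlMr ?mulr_gt0// mulrA divfK// mul1r.
have lxC : l <= ln C1 - v * lH.
  have : l <= ln (C1 * H `^ (- v)) by rewrite ler_ln ?posrE ?mulr_gt0 ?powR_gt0.
  by rewrite lnM ?posrE ?powR_gt0// ln_powR expRK mulNr.
(* This sign allows -l >= w L to be multiplied by v - (m + 1). *)
have vm : m.+1%:R < v.
  rewrite -(ltr_pM2r (_ : 0 < w - n%:R)); last by lra.
  apply: le_lt_trans vw; rewrite ler_wpM2l ?(ltW m0)// gerBl//.
have : m.+1%:R * l <= m.+1%:R * ln C1 - v * (ln c - l - n%:R * L).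
  rewrite -lHE [v * (_ * _)]mulrCA -mulrBr ler_wpM2l ?(ltW m0)//.
have : (v - m.+1%:R) * (- l) >= (v - m.+1%:R) * (w * L).
  rewrite ler_wpM2l//; first by rewrite subr_ge0 ltW.
  by rewrite lerNr.
(* The last two inequalities give del L <= (m + 1) ln C1 - v ln c, against the third threshold. *)
move: Kd; rewrite /del; nra.
Qed.

End LargeExponent.

(** * Passage to the suprema and the final case analysis *)

Section Bounds.
Variables (R : realType) (xi : R).
Hypothesis xi_tr : transcendental xi.

Lemma what_star_le (n : nat) (y : \bar R) : (0 <= y)%E ->
  (forall v, 0 < v -> uniform_star xi n v -> (v%:E <= y)%E) ->
  (what_star_exp n xi <= y)%E.
Proof.
move=> y0 vy; apply: ge_ereal_sup => _ [v nv <-].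
have [v0|v0] := ltP 0 v; first exact: vy.
by apply: le_trans y0; rewrite lee_fin.
Qed.

Lemma uniform_star_lt_w (m n : nat) (v w : R) :
  n%:R + m.+1%:R < w -> (w%:E < w_exp m.+1 xi)%E ->
  0 < v -> uniform_star xi n.+1 v -> v * (w - n%:R) <= m.+1%:R * w.
Proof.
move=> nmw /ereal_sup_gt[_ [w' infP <-]]; rewrite lte_fin => ww'.
exact: uniform_star_large_w infP.
Qed.

Lemma what_star_le_of_w_pinfty (m n : nat) : w_exp m.+1 xi = +oo%E ->
  (what_star_exp n.+1 xi <= m.+1%:R%:E)%E.
Proof.
move=> Woo; apply: what_star_le => [|v v0 nv]; first by rewrite lee_fin.
rewrite lee_fin leNgt; apply/negP => mv.
have vm0 : 0 < v - m.+1%:R by rewrite subr_gt0.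
(* Beyond v n / (v - (m + 1)) the inequality v (w - n) <= (m + 1) w fails; the other summands put w
   above n + m + 1. *)
pose w := n%:R + m.+1%:R + 1 + v * n%:R / (v - m.+1%:R).
have q0 : 0 <= v * n%:R / (v - m.+1%:R).
  by rewrite divr_ge0 ?mulr_ge0 ?(ltW v0) ?(ltW vm0).
have := @uniform_star_lt_w m n v w; rewrite Woo ltry => /(_ _ isT v0 nv).
have -> : n%:R + m.+1%:R < w.
  by apply: (@lt_le_trans _ _ (n%:R + m.+1%:R + 1)); rewrite ?ltrDl// lerDl.
move=> /(_ isT); apply/negP; rewrite -ltNge.
have : (v - m.+1%:R) * w = v * n%:R + (v - m.+1%:R) * (n%:R + m.+1%:R + 1).
  by rewrite /w mulrDr addrC [_ * (_ / _)]mulrC divfK ?gt_eqF.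
have : 0 < (v - m.+1%:R) * (n%:R + m.+1%:R + 1).
  by rewrite mulr_gt0// ltr_wpDl// addr_ge0.
lra.
Qed.

(** This is v (w - n) <= (m + 1) w as w increases to r. *)
Lemma what_star_le_of_w_large (m n : nat) (r : R) :
  w_exp m.+1 xi = r%:E -> n%:R + m.+1%:R < r ->
  (what_star_exp n.+1 xi <= (m.+1%:R * r / (r - n%:R))%:E)%E.
Proof.
move=> Wr nmr; have m0 : 0 <= m.+1%:R :> R by [].
have n0 : 0 <= n%:R :> R by [].
have rn0 : 0 < r - n%:R by lra.
apply: what_star_le => [|v v0 nv].
  by rewrite lee_fin divr_ge0 ?mulr_ge0//; lra.
rewrite lee_fin ler_pdivlMr// leNgt; apply/negP => vr.
pose del := v * (r - n%:R) - m.+1%:R * r.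
have del0 : 0 < del by rewrite subr_gt0.
pose D := `|v - m.+1%:R| + 1.
have D0 : 0 < D by rewrite ltr_wpDl.
have vD : v - m.+1%:R <= D by rewrite (le_trans (ler_norm _))// lerDl.
(* Lowering w from r to r - t keeps it above n + m + 1 and, as t (v - (m + 1)) <= t D <= del / 2,
   preserves v (w - n) > (m + 1) w. *)
pose t := Num.min ((r - n%:R - m.+1%:R) / 2) (del / (2 * D)).
have t0 : 0 < t by rewrite lt_min !divr_gt0 ?mulr_gt0//; lra.
have t1 : t <= (r - n%:R - m.+1%:R) / 2 by rewrite ge_min lexx.
have t2 : t * D <= del / 2.
  have : t <= del / (2 * D) by rewrite ge_min lexx orbT.
  by rewrite invfM mulrA -ler_pdivrMr ?invr_gt0// invrK.
have := @uniform_star_lt_w m n v (r - t).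
rewrite Wr lte_fin => /(_ _ _ v0 nv).
have -> : n%:R + m.+1%:R < r - t by lra.
have -> : r - t < r by lra.
move=> /(_ isT isT); apply/negP; rewrite -ltNge.
have : t * (v - m.+1%:R) <= t * D by rewrite ler_wpM2l ?(ltW t0).
move: del0; rewrite /del in t2 *; lra.
Qed.

Lemma what_star_le_min (m n : nat) :
  (n < m.+1)%N \/
    (Order.min (n.+1%:R + m.+1%:R - 1)%R%:E (wstar_exp n.+1 xi) <
      w_exp m.+1 xi)%E ->
  (what_star_exp n.+1 xi <= Order.min
    (m.+1%:R%:E + (n.+1%:R - 1)%R%:E * (what_star_exp n.+1 xi / w_exp m.+1 xi))
    (w_exp m.+1 xi))%E.
Proof.
have -> : n.+1%:R + m.+1%:R - 1 = n%:R + m.+1%:R :> R by rewrite -natr1; ring.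
have -> : n.+1%:R - 1 = n%:R :> R by rewrite -natr1; ring.
move=> hyp.
have W0 := w_exp_ge0 xi_tr (ltn0Sn m).
have V0 := what_star_ge0 xi_tr (ltn0Sn n).
have m0 : 0 < m.+1%:R :> R by rewrite ltr0n.
have n0 : 0 <= n%:R :> R by [].
(* For W in this range, the hypothesis on the minimum can hold only through [wstar_exp n.+1 xi]. *)
have VW : (w_exp m.+1 xi <= (n%:R + m.+1%:R)%:E)%E ->
    (what_star_exp n.+1 xi <= w_exp m.+1 xi)%E.
  move=> Wle; apply: what_star_le => // v v0 nv.
  case: hyp => [nm|]; first exact: uniform_star_le_w nv.
  rewrite gt_min => /orP[|wstarW]; first by rewrite ltNge Wle.
  exact: le_trans (uniform_star_le_wstar v0 nv) (ltW wstarW).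
rewrite le_min.
case WE : (w_exp m.+1 xi) => [r| |]; last by move: W0; rewrite WE.
  have r0 : 0 <= r by rewrite -lee_fin -WE.
  (* For r > 0, the last inequality is s <= (m + 1) + n s / r multiplied by r. *)
  suff [s VE [sr smr]] : exists2 s : R, what_star_exp n.+1 xi = s%:E &
      s <= r /\ s * (r - n%:R) <= m.+1%:R * r.
    have s0 : 0 <= s by rewrite -lee_fin -VE.
    rewrite VE lee_fin sr andbT.
    (* If r = 0 then s = 0, and the quotient is 0 whatever value 0^-1 takes. *)
    have [r00|rn0] := eqVneq r 0.
      have -> : s = 0 by apply/eqP; rewrite eq_le s0 -r00 sr.
      by rewrite mul0e mule0 adde0 lee_fin ltW.
    have rgt0 : 0 < r by rewrite lt_neqAle eq_sym rn0.
    rewrite inver (negbTE rn0) -!EFinM -EFinD lee_fin.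
    rewrite -(ler_pM2r rgt0) mulrDl -mulrA divfK//; lra.
  have [large|small] := ltP (n%:R + m.+1%:R) r.
    have rn0 : 0 < r - n%:R by lra.
    have := what_star_le_of_w_large WE large.
    case: (what_star_exp n.+1 xi) V0 => [s| |]//.
    rewrite !lee_fin => s0; rewrite ler_pdivlMr// => smr.
    exists s => //; split=> //.
    rewrite -(ler_pM2r rn0) (le_trans smr)// mulrC ler_wpM2l//; lra.
  have := VW; rewrite WE lee_fin => /(_ small).
  case: (what_star_exp n.+1 xi) V0 => [s| |]//.
  rewrite !lee_fin => s0 sr; exists s => //; split=> //.
  (* For r >= n, combine s <= r with r - n <= m + 1; for r < n the left side is at most 0. *)
  have [rn|rn] := leP 0 (r - n%:R).
    rewrite mulrC ler_pM//; lra.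
  apply: (@le_trans _ _ 0); last by rewrite mulr_ge0 ?(ltW m0).
  by rewrite mulr_ge0_le0 ?(ltW rn).
(* For infinite W the quotient is 0, and the bound reads V <= m + 1. *)
by rewrite leey andbT invey !mule0 adde0; exact: what_star_le_of_w_pinfty.
Qed.

End Bounds.

Local Open Scope ereal_scope.

(* In \bar R, +oo^-1 = 0 and x * 0 = 0, so x / +oo = 0. *)
Theorem theorem2p4 (R : realType) :
  (forall (m n : nat) (xi : R),
    (0 < m)%N -> (0 < n)%N -> transcendental xi ->
    (n <= m)%N \/
      Order.min (n%:R + m%:R - 1)%R%:E (wstar_exp n xi) < w_exp m xi ->
    what_star_exp n xi <=
      Order.min
        (m%:R%:E + (n%:R - 1)%R%:E * (what_star_exp n xi / w_exp m xi))
        (w_exp m xi)) /\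
  (forall (n : nat) (xi : R),
    (0 < n)%N -> transcendental xi ->
    what_star_exp n xi <=
      n%:R%:E + (n%:R - 1)%R%:E * (what_star_exp n xi / w_exp n xi)).
Proof.
split=> [[//|m] [//|n] xi _ _ xi_tr|[//|n] xi _ xi_tr].
  exact: what_star_le_min.
have := what_star_le_min xi_tr (or_introl (ltnSn n)).
by rewrite le_min => /andP[].
Qed.
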